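(* Let $X$ be the blowup of $\mathbb{P}^3$ along a point $p$ and two intersecting distinct lines $\ell_1$ and $\ell_2$ (torus-invariant, blown up in this order), such that $p\neq\ell_1\cap\ell_2$. Then, given $\beta=dh-a_1e-a_2f_1-a_3f_2\in H_2(X;\mathbb{Z})$, there exists a unique nontrivial toric symmetry $\tau_A$ on $X$, and its action on homology is given by $(\tau_A)_*\beta=\beta'$, where $\beta'=d'h-a_1'e-a_2'f_1-a_3'f_2$ has coefficients $$d'=2d-a_1-a_2-a_3,\quad a_1'=d-a_2-a_3,\quad a_2'=d-a_1-a_3,\quad a_3'=d-a_1-a_2.$$
   Context: Work over $\mathbb{C}$. Such an $X$ is called a Class A blowup. The fan of $\mathbb{P}^3$ in $\mathbb{Z}^3$ has rays generated by $v_1=(-1,-1,-1)$, $v_2=(1,0,0)$, $v_3=(0,1,0)$, $v_4=(0,0,1)$ and maximal cones $\langle v_i,v_j,v_k\rangle$ for $i<j<k$. The torus-fixed point $p_{ijk}$ is the orbit closure of $\langle v_i,v_j,v_k\rangle$ and the torus-invariant line $\ell_{ij}$ is that of $\langle v_i,v_j\rangle$. Blowing up $p_{ijk}$ (resp. the proper transform of $\ell_{rs}$) subdivides the fan by inserting the ray $v_{ijk}=v_i+v_j+v_k$ (resp. $v_{rs}=v_r+v_s$). A toric symmetry of $X$ is an automorphism of the lattice $\mathbb{Z}^3$ which permutes the cones of the fan $\Sigma_X$; it induces an automorphism of $X$. The primitive ray generators of $\Sigma_X$ form three sets: $\{v_1,\dots,v_4\}$, the $v_{ijk}$ of blown-up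 points, and the $v_{rs}$ of blown-up lines. A toric symmetry is nontrivial if it does not map each of these three sets to itself. Classes: $h$ is the pullback to $X$ of the class of a line in $\mathbb{P}^3$, $e$ is the class of a line in the exceptional divisor above $p$, and $f_i$ is the fibre class in the exceptional divisor above $\ell_i$. $H_2(X;\mathbb{Z})$ is spanned by $h,e,f_1,f_2$.
   Formalization: The condition p ≠ ℓ1∩ℓ2 is strengthened to: p lies on neither ℓ1 nor ℓ2; if p lies on exactly one of the lines (e.g. p_124, ℓ_12, ℓ_13), no invariant divisor has class H−F1−F2, so the stated action is impossible. *)

(* Defs.v *)
From HB Require Import structures.
From mathcomp Require Import all_boot all_order all_algebra perm finmap.

Set Implicit Arguments.
Unset Strict Implicit.
Unset Printing Implicit Defensive.

Import GRing.Theory.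
Local Open Scope ring_scope.
Local Open Scope fset_scope.

(* Plain MathComp.  Smooth complete toric threefolds are given by their fans;
   a cone is recorded by its finite set of primitive ray generators, and a fan
   by the finite set of all its cones (every dimension, [fset0] included). *)

Notation lattice := 'cV[int]_3.
Notation cone := {fset lattice}.
Notation fan := {fset {fset lattice}}.

Definition rays (S : fan) : {fset lattice} := fcover S.

Definition barycenter (t : cone) : lattice := \sum_(u <- t) u.

(* Star subdivision of [S] at its cone [t], i.e. the blowup of the orbit
   closure of [t] (in a smooth fan the inserted ray is the sum of the
   generators of [t]). *)
Definition blowup (t : cone) (S : fan) : fan :=
  [fset s in S | ~~ (t `<=` s)] `|`
  \bigcup_(s <- S | t `<=` s)
     [fset A in fpowerset (barycenter t |` s) | ~~ (t `<=` A)].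

(* The index 0 plays the role of v_1 = (-1,-1,-1). *)
Definition v (i : 'I_4) : lattice :=
  if unlift ord0 i is Some j then delta_mx j 0 else const_mx (-1).

Definition gens (I : {set 'I_4}) : cone := [fset v i | i in I].

Definition P3 : fan :=
  [fset gens I | I in [set I : {set 'I_4} | I \proper [set: 'I_4]]].

(* The torus-fixed points p_ijk and the torus-invariant lines l_ij of P^3. *)
Definition point := {I : {set 'I_4} | #|I| == 3}.
Definition line := {I : {set 'I_4} | #|I| == 2}.

(* Orbit closures reverse inclusion of cones. *)
Definition on_line (l : line) (p : point) : bool := sval l \subset sval p.

(* The intersection of two torus-invariant lines is closed and
   torus-invariant, so if nonempty it contains a torus-fixed point. *)
Definition meet (l1 l2 : line) : bool :=
  [exists q : point, on_line l1 q && on_line l2 q].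

Definition v_point (p : point) : lattice := barycenter (gens (sval p)).
Definition v_line (l : line) : lattice := barycenter (gens (sval l)).

(* The fan of the blowup of P^3 at p, then along the proper transform of l1,
   then along the proper transform of l2. *)
Definition fanX (p : point) (l1 l2 : line) : fan :=
  blowup (gens (sval l2)) (blowup (gens (sval l1)) (blowup (gens (sval p)) P3)).

Definition permutes_cones (S : fan) (g : 'M[int]_3) : bool :=
  [fset [fset g *m u | u in s] | s : cone in S] == S.

Record toric_symmetry (S : fan) := ToricSymmetry {
  sym_mx :> 'M[int]_3;
  sym_mxP : (sym_mx \in unitmx) && permutes_cones S sym_mx }.

HB.instance Definition _ S := [isSub for @sym_mx S].
HB.instance Definition _ S := [Choice of toric_symmetry S by <:].

Definition preserves (g : 'M[int]_3) (A : {fset lattice}) : Prop :=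
  [fset g *m u | u in A] = A.

Definition nontrivial (p : point) (l1 l2 : line)
    (g : toric_symmetry (fanX p l1 l2)) : Prop :=
  ~ [/\ preserves g (gens setT),
        preserves g [fset v_point p]
      & preserves g [fset v_line l1; v_line l2]].

(* For the smooth complete toric variety X of S, H^2(X;Z) = Pic X is the group
   of torus-invariant divisors sum_r c_r D_r modulo the divisors
   sum_r <m, r> D_r of characters m, and H_2(X;Z) = Hom(H^2(X;Z), Z).  A class
   b is therefore recorded by its intersection numbers b r = D_r . b, subject
   to sum_r <m, r> b r = 0 for all m. *)
Definition is_class (S : fan) : {pred {ffun rays S -> int}} :=
  fun b => \sum_(r : rays S) b r *: val r == 0.

Fact is_class_closed S : zmod_closed (@is_class S).
Proof.
split=> [|b c].
  by rewrite unfold_in big1 // => r _; rewrite ffunE scale0r.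
rewrite !unfold_in => /eqP b0 /eqP c0.
under eq_bigr => r _ do rewrite !ffunE scalerBl.
by rewrite sumrB b0 c0 subr0.
Qed.
HB.instance Definition _ S :=
  GRing.isZmodClosed.Build _ (@is_class S) (@is_class_closed S).

Record H2 (S : fan) := HomologyClass {
  inter :> {ffun rays S -> int};
  interP : inter \in @is_class S }.

HB.instance Definition _ S := [isSub for @inter S].
HB.instance Definition _ S := [Choice of H2 S by <:].
HB.instance Definition _ S := [SubChoice_isSubZmodule of H2 S by <:].

Section Pushforward.
Variables (S : fan) (g : toric_symmetry S).

Fact sym_ray_subproof (r : rays S) : g *m val r \in rays S.
Proof.
case/andP: (sym_mxP g) => _ /eqP gS.
case/bigfcupP: (valP r) => s; rewrite andbT => sS rs.
apply/bigfcupP; exists [fset g *m u | u in s]; last exact: in_imfset.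
rewrite andbT; suff: [fset g *m u | u in s] \in S by [].
by rewrite -[X in _ \in X]gS; apply/imfsetP; exists s.
Qed.

Definition sym_ray (r : rays S) : rays S := [` sym_ray_subproof r].

Fact sym_ray_inj : injective sym_ray.
Proof.
case/andP: (sym_mxP g) => gU _ r r' /(congr1 val) /= /(congr1 (mulmx (invmx g))).
by rewrite !mulKmx // => /val_inj.
Qed.

Definition sym_perm : {perm rays S} := perm sym_ray_inj.

Fact pushforward_subproof (b : H2 S) :
  [ffun r => b ((sym_perm^-1)%g r)] \in @is_class S.
Proof.
rewrite unfold_in (reindex_perm sym_perm) /=.
under eq_bigr => r _ do rewrite ffunE permK permE /= scalemxAr.
by rewrite -mulmx_sumr (eqP (interP b)) mulmx0.
Qed.

(* The automorphism of X induced by g maps D_r onto D_(g r), so the image of a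
   class b has intersection number D_r . b with D_(g r). *)
Definition pushforward (b : H2 S) : H2 S :=
  HomologyClass (pushforward_subproof b).

End Pushforward.

(* The function with value 1 at u and 0 at the other rays. *)
Definition delta (S : fan) (u : lattice) : {ffun rays S -> int} :=
  [ffun r => (val r == u)%:R].

Lemma sum_delta (S : fan) (u : lattice) :
  u \in rays S -> \sum_(r : rays S) delta S u r *: val r = u.
Proof.
move=> uS; rewrite (bigD1 [` uS]) //= ffunE eqxx scale1r big1 ?addr0 // => r.
by rewrite -val_eqE /= ffunE => /negPf->; rewrite scale0r.
Qed.

Lemma v_inj : injective v.
Proof.
rewrite /v => i j.
case: (unliftP ord0 i) => [i'|] ->; case: (unliftP ord0 j) => [j'|] -> //=.
- move=> /matrixP /(_ i' 0); rewrite !mxE !eqxx /=.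
  by case: eqP => [->|].
- by move=> /matrixP /(_ i' 0); rewrite !mxE !eqxx.
- by move=> /matrixP /(_ j' 0); rewrite !mxE !eqxx.
Qed.

Lemma card_gens (I : {set 'I_4}) : #|` gens I| = #|I|.
Proof. by rewrite /gens card_imfset ?cardE //=; apply: v_inj. Qed.

Lemma gensS (I J : {set 'I_4}) : (gens I `<=` gens J) = (I \subset J).
Proof.
apply/fsubsetP/subsetP => [sIJ i iI | sIJ _ /imfsetP[i /= iI ->]].
  have /sIJ/imfsetP[j /= jJ /v_inj->] // : v i \in gens I.
  by apply/imfsetP; exists i.
by apply/imfsetP; exists i => //=; apply: sIJ.
Qed.

Lemma sum_v : \sum_i v i = 0.
Proof.
rewrite big_ord_recl /v unlift_none.
under eq_bigr => i _ do rewrite liftK.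
apply/matrixP => i j; rewrite !mxE summxE (bigD1 i) //= big1 ?addr0 => [|k ki].
  by rewrite mxE eqxx (ord1 j).
by rewrite mxE eq_sym (negPf ki).
Qed.

Section Blowup.
Variables (t : cone) (S : fan).
Hypothesis t1 : (1 < #|` t|)%N.

Lemma blowup_keep s : s \in S -> ~~ (t `<=` s) -> s \in blowup t S.
Proof. by move=> sS ts; rewrite in_fsetU !inE /= sS ts. Qed.

Lemma blowup_singleton s u : s \in S -> t `<=` s ->
  u \in barycenter t |` s -> u \in rays (blowup t S).
Proof.
move=> sS ts us; apply/bigfcupP; exists [fset u]; last by rewrite inE.
rewrite andbT in_fsetU; apply/orP; right; apply/bigfcupP; exists s.
  by rewrite sS.
rewrite !inE /= fpowersetE fsub1set us /=.
by apply: contraTN t1 => /fsubset_leq_card; rewrite cardfs1 leqNgt.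
Qed.

Lemma blowup_old u : u \in rays S -> u \in rays (blowup t S).
Proof.
case/bigfcupP=> s; rewrite andbT => sS us.
have [ts|ts] := boolP (t `<=` s).
  by apply: (blowup_singleton sS ts); rewrite inE us orbT.
by apply/bigfcupP; exists s => //; rewrite blowup_keep.
Qed.

Lemma blowup_new : t \in S -> barycenter t \in rays (blowup t S).
Proof. by move=> tS; apply: (blowup_singleton tS); rewrite ?fset1U1. Qed.

End Blowup.

Section Classes.
Variables (p : point) (l1 l2 : line).
Local Notation S := (fanX p l1 l2).

Let p1 : (1 < #|` gens (sval p)|)%N.
Proof. by rewrite card_gens (eqP (valP p)). Qed.
Let line1 (l : line) : (1 < #|` gens (sval l)|)%N.
Proof. by rewrite card_gens (eqP (valP l)). Qed.

Let P3_gens (I : {set 'I_4}) : (#|I| < 4)%N -> gens I \in P3.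
Proof.
move=> I4; apply/imfsetP; exists I => //=.
by rewrite inE properEcard subsetT cardsT card_ord.
Qed.

Let line_gens (l : line) : gens (sval l) \in blowup (gens (sval p)) P3.
Proof.
apply: blowup_keep; first by rewrite P3_gens // (eqP (valP l)).
apply: contraTN isT => /fsubset_leq_card.
by rewrite !card_gens (eqP (valP p)) (eqP (valP l)).
Qed.

Lemma v_rays i : v i \in rays S.
Proof.
do 3![apply: blowup_old => //].
apply/bigfcupP; exists (gens [set i]).
  by rewrite andbT P3_gens // cards1.
by apply/imfsetP; exists i; rewrite //= inE.
Qed.

Lemma v_point_rays : v_point p \in rays S.
Proof.
do 2![apply: blowup_old => //]; apply: blowup_new => //.
by rewrite P3_gens // (eqP (valP p)).
Qed.

Lemma v_line1_rays : v_line l1 \in rays S.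
Proof. by apply: blowup_old => //; apply: blowup_new. Qed.

Lemma v_line2_rays : v_line l2 \in rays S.
Proof.
have [<-|l12] := eqVneq l1 l2.
  by apply: blowup_old => //; apply: blowup_new.
apply: blowup_new => //; apply: blowup_keep => //.
rewrite gensS; apply: contra l12 => l12.
by rewrite -val_eqE eqEcard l12 (eqP (valP l1)) (eqP (valP l2)).
Qed.

(* Pullback of curve classes along X -> P^3 is dual to the pushforward of
   divisors, which kills the exceptional ones: the pullback of the class of a
   line meets D_(v i) once and the exceptional divisors zero times. *)
Fact h_subproof : \sum_i delta S (v i) \in @is_class S.
Proof.
rewrite unfold_in.
under eq_bigr => r _ do rewrite sum_ffunE scaler_suml.
rewrite exchange_big /=.
under eq_bigr => i _ do rewrite sum_delta ?v_rays //.
by rewrite sum_v.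
Qed.
Definition h : H2 S := HomologyClass h_subproof.

Fact exceptional_subproof (I : {set 'I_4}) :
  barycenter (gens I) \in rays S ->
  \sum_(i in I) delta S (v i) - delta S (barycenter (gens I)) \in @is_class S.
Proof.
move=> IS; rewrite unfold_in.
have subE (A B : {ffun rays S -> int}) r : (A - B) r = A r - B r.
  by rewrite !ffunE.
under eq_bigr => r _ do rewrite subE sum_ffunE scalerBl scaler_suml.
rewrite sumrB exchange_big /= sum_delta //.
under eq_bigr => i _ do rewrite sum_delta ?v_rays //.
rewrite /barycenter /gens big_imfset /= => [|i j _ _]; last exact: v_inj.
by rewrite big_enum subrr.
Qed.

(* The class of a line in a general fibre of the exceptional divisor E of the
   blowup of the orbit closure of the cone <v i : i in I>, this fibre being a
   projective space: O(E) restricts to O(-1) on it, the proper transforms of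
   the D_(v i) with i in I to O(1), and all other D_r trivially.  Blowing up
   other centres does not affect the general such line. *)
Definition exceptional_class (I : {set 'I_4})
    (IS : barycenter (gens I) \in rays S) : H2 S :=
  HomologyClass (exceptional_subproof IS).

Definition e : H2 S := exceptional_class v_point_rays.
Definition f1 : H2 S := exceptional_class v_line1_rays.
Definition f2 : H2 S := exceptional_class v_line2_rays.

Definition class_of (d a1 a2 a3 : int) : H2 S :=
  h *~ d - e *~ a1 - f1 *~ a2 - f2 *~ a3.

End Classes.

(* Main.v *)
Require Import Defs.
From mathcomp Require Import all_boot all_order all_algebra perm finmap.
From mathcomp Require Import zify ring.

Set Implicit Arguments.
Unset Strict Implicit.
Unset Printing Implicit Defensive.

Import GRing.Theory.
Local Open Scope fset_scope.
Local Open Scope ring_scope.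

(* Let i be the index off p, so that v_p = -v_i, and write l1 = l_ij, l2 = l_ik
   and m for the remaining index.  The fan consists of the sets of rays
   containing no minimal nonface (primitive collection), and a star subdivision
   at t with new ray b adds to the nonfaces t itself and b |` (Q `\` t) for each
   old nonface Q.  The nonfaces with two elements form the edges of the graph

            v_k -- v_i -- v_j
                    |      |
          v_l1 -- v_p -- v_l2           (v_m isolated)

   whose only nonidentity automorphism exchanges v_i with v_p, v_j with v_l2 and
   v_k with v_l1, and fixes v_m.  It is linear and preserves all nonfaces.  A
   symmetry is determined by its action on the rays, so this is the only one
   besides the identity; its action on classes is read off the intersection
   numbers with the seven divisors. *)

(** * Linear maps prescribed on the generators of the fan of P^3 *)

Lemma v_extend n (f : 'I_4 -> 'cV[int]_n) : \sum_x f x = 0 ->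
  exists M : 'M[int]_(n, 3), forall x, M *m v x = f x.
Proof.
rewrite big_ord_recl => /eqP; rewrite addr_eq0 => /eqP f0.
(* The [v (lift ord0 b)] are the standard basis, so their images are the columns; [v ord0] is minus
   their sum. *)
exists (\matrix_(a, b) f (lift ord0 b) a 0) => x; apply/colP => a.
rewrite /v mxE; case: unliftP => [b|] ->.
  rewrite (bigD1 b) //= big1 ?addr0 => [|c cb].
    by rewrite !mxE !eqxx mulr1.
  by rewrite !mxE (negPf cb) mulr0.
rewrite f0 mxE summxE -sumrN; apply: eq_bigr => b _.
by rewrite !mxE mulrN1.
Qed.

Lemma v_ext n (M N : 'M[int]_(n, 3)) : (forall x, M *m v x = N *m v x) -> M = N.
Proof.
move=> MN; apply/matrixP => a b.
have := MN (lift ord0 b); rewrite /v liftK -!colE.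
by move=> /colP/(_ a); rewrite !mxE.
Qed.

(** * Fans described by nonfaces, and their star subdivisions *)

Definition avoiding (R : cone) (C : seq cone) (A : cone) : bool :=
  (A `<=` R) && all (fun Q => ~~ (Q `<=` A)) C.

(** [C] may contain redundant nonfaces. The second clause keeps a newly inserted ray out of every
    old nonface. *)
Definition fan_avoiding (R : cone) (C : seq cone) (S : fan) : Prop :=
  (forall A, (A \in S) = avoiding R C A) /\ {in C, forall Q, Q `<=` R}.

(** This fan is the boundary complex of a tetrahedron, whose only minimal nonface is the full vertex
    set. *)
Lemma P3_avoiding : fan_avoiding (gens setT) [:: gens setT] P3.
Proof.
split=> [A|Q]; last by rewrite inE => /eqP->; apply: fsubset_refl.
rewrite [RHS]/avoiding /= andbT; apply/imfsetP/andP.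
  case=> I /=; rewrite inE => ltI ->.
  by rewrite !gensS subsetT; case/properP: ltI => _ [x _ xI]; split => //;
    apply: contra xI => /subsetP ->.
case=> /fsubsetP AT TA; exists [set x | v x \in A].
  rewrite /= inE properE subsetT /=; apply: contra TA => /subsetP TA.
  by apply/fsubsetP => _ /imfsetP[x _ ->]; have := TA x; rewrite !inE; apply.
apply/fsetP => u; apply/idP/imfsetP => [uA | [x]].
  by have /imfsetP[x _ ux] := AT u uA; exists x; rewrite //= inE -ux.
by rewrite /= inE => ? ->.
Qed.

(** A set [A] containing the new ray [b] is a cone iff it does not contain [t] and [t]|[A]\
    b[is a cone of]S[; an old nonface]Q[lies in the latter iff]b |[(Q]\[t)] lies in [A]. If [b] is
    not in [A], the nonfaces through [b] impose nothing. *)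
Lemma blowup_avoiding (t : cone) (S : fan) (R : cone) (C : seq cone) :
    fan_avoiding R C S -> t `<=` R -> barycenter t \notin R ->
  fan_avoiding (barycenter t |` R)
    (t :: C ++ [seq barycenter t |` (Q `\` t) | Q <- C]) (blowup t S).
Proof.
set b := barycenter t => -[inS CR] tR bR; split=> [A|Q]; last first.
  have RbR : R `<=` b |` R := fsubsetUr _ _.
  rewrite inE mem_cat => /or3P[/eqP->|/CR QR|/mapP[Q' /CR QR ->]].
  - exact: fsubset_trans tR RbR.
  - exact: fsubset_trans QR RbR.
  - by apply: fsetUS; apply: fsubset_trans (fsubsetDl _ _) QR.
have star : (A \in \bigcup_(s <- S | t `<=` s)
     [fset A in fpowerset (b |` s) | ~~ (t `<=` A)]) =
     ~~ (t `<=` A) && (t `|` A `\ b \in S).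
  apply/bigfcupP/andP => [[s /andP[sS ts]]|[tA AS]].
    rewrite !inE /= fpowersetE => /andP[As ->]; split=> //.
    have sub : t `|` A `\ b `<=` s by rewrite fsubUset ts fsubDset.
    move: sS; rewrite !inS /avoiding => /andP[sR sC].
    rewrite (fsubset_trans sub) //=.
    by apply: sub_all sC => Q; apply: contra => /fsubset_trans; apply.
  exists (t `|` A `\ b); first by rewrite AS fsubsetUl.
  by rewrite !inE /= fpowersetE tA andbT -fsubDset fsubsetUr.
rewrite /blowup in_fsetU star !inE /= !inS /avoiding /= all_cat all_map.
case: (boolP (t `<=` A)) => tA; first by rewrite !andbF.
rewrite /= !andbT fsubUset tR /= fsubDset.
have [bA|bA] := boolP (b \in A).
  have /negPf -> /= : ~~ (A `<=` R) by apply: contra bR => /fsubsetP; apply.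
  congr andb; rewrite -all_predI; apply: eq_in_all => Q /CR QR /=.
  have bQ : b \notin Q by apply: contra bR; apply/fsubsetP.
  have -> : (b |` Q `\` t `<=` A) = (Q `<=` t `|` A `\ b).
    rewrite fsubUset fsub1set bA fsubDset /=.
    apply/fsubsetP/fsubsetP => sQ u uQ.
      have := sQ u uQ; rewrite !inE; have [ub|//] := eqVneq u b.
      by rewrite -ub uQ in bQ.
    by have := sQ u uQ; rewrite !inE => /orP[->//|/andP[_ ->]]; rewrite orbT.
  apply/idP/andP => [nQ|[]//]; split=> //; apply: contra nQ => QA.
  by apply/fsubsetP => u uQ; rewrite !inE (fsubsetP QA) // andbT
     (contraNneq _ bQ) ?orbT // => <-.
have -> : A `\ b = A by apply/fsetDidPl; rewrite fdisjointX1.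
have -> : (A `<=` b |` R) = (A `<=` R).
  apply/idP/idP => [|AR]; last exact: fsubset_trans AR (fsubsetUr _ _).
  by rewrite -fsubDset; congr (_ `<=` _); apply/fsetDidPl; rewrite fdisjointX1.
rewrite [X in _ = _ && (_ && X)](_ : _ = true) ?andbT; last first.
  by apply/allP => Q _ /=; rewrite fsubUset fsub1set (negPf bA).
case: (A `<=` R) => //=; apply/orb_idr/sub_all => Q.
by apply: contra => /fsubset_trans; apply; exact: fsubsetUr.
Qed.

Lemma barycenter_gens (I : {set 'I_4}) :
  barycenter (gens I) = \sum_(x in I) v x.
Proof.
rewrite /barycenter /gens big_imfset /= => [|x y _ _]; last exact: v_inj.
by rewrite big_enum.
Qed.

(** * Cones coded by lists of labels *)

Section LabelledRays.
Variables (r : nat -> lattice) (N : nat).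
Hypothesis eq_r : forall a b, (a < N)%N -> (b < N)%N -> (r a == r b) = (a == b).

Definition face (q : seq nat) : cone := [fset u in [seq r a | a <- q]].

Lemma face_sub q A : (face q `<=` A) = all (fun a => r a \in A) q.
Proof.
apply/fsubsetP/allP => [qA a aq|qA u]; first by rewrite qA // inE map_f.
by rewrite inE => /mapP[a aq ->]; apply: qA.
Qed.

Lemma mem_face a q : (a < N)%N -> all (gtn N) q -> (r a \in face q) = (a \in q).
Proof.
move=> aN /allP qN; rewrite inE; apply/mapP/idP => [[b bq /eqP]|].
  by rewrite eq_r // => [/eqP->|]; last exact: qN.
by exists a.
Qed.

Lemma face_blowup n t C S :
    fan_avoiding (face (iota 0 n)) [seq face q | q <- C] S ->
    barycenter (face t) = r n ->
    (n < N)%N -> all (gtn n) t -> all (all (gtn n)) C ->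
  fan_avoiding (face (iota 0 n.+1))
    [seq face q | q <- t :: C ++ [seq n :: filter (predC (mem t)) q | q <- C]]
    (blowup (face t) S).
Proof.
move=> SC tb nN tn /allP Cn.
have gtnN q : all (gtn n) q -> all (gtn N) q.
  by apply: sub_all => a /ltn_trans; apply.
have tR : face t `<=` face (iota 0 n).
  rewrite face_sub; apply/allP => a /(allP tn) an; rewrite inE map_f //.
  by rewrite mem_iota.
have nR : r n \notin face (iota 0 n).
  rewrite mem_face ?mem_iota ?ltnn //.
  by apply/gtnN/allP => a; rewrite mem_iota.
have := blowup_avoiding SC tR; rewrite tb => /(_ nR).
have -> : r n |` face (iota 0 n) = face (iota 0 n.+1).
  apply/fsetP => u; rewrite -[n.+1]addn1 /face iotaD map_cat in_fset1U !in_fset.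
  by rewrite mem_cat inE orbC.
rewrite -map_comp /= map_cat -!map_comp.
congr (fan_avoiding _ (_ :: _ ++ _) _); apply/eq_in_map => q /Cn qn /=.
apply/fsetP => u; rewrite in_fset1U in_fsetD [RHS]in_fset /= in_cons.
congr orb; apply/andP/mapP => [[ut]|[a]].
  rewrite inE => /mapP[a aq ua]; exists a => //; rewrite mem_filter aq andbT /=.
  by apply: contra ut => ta; rewrite ua inE map_f.
rewrite mem_filter => /andP[/= ta aq ->]; split; last by rewrite inE map_f.
by rewrite mem_face ?gtnN //; apply: ltn_trans nN; apply: (allP qn).
Qed.

End LabelledRays.

(** * The seven rays and the fan of X *)

Section Rays.
Variables i j k m : 'I_4.
Hypothesis ijkm : uniq [:: i; j; k; m].

Lemma mem_ijkm x : x \in [:: i; j; k; m].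
Proof.
have [||_ ->] := uniq_min_size ijkm (s2 := enum 'I_4).
- by move=> y _; rewrite mem_enum.
- by rewrite size_enum_ord.
- by rewrite mem_enum.
Qed.

Lemma neq_ijk : i != j /\ i != k.
Proof.
by move: ijkm; rewrite /= !inE !negb_or => /andP[/and3P[-> -> _] _].
Qed.

Lemma sum_ijkm (V : nmodType) (F : 'I_4 -> V) :
  \sum_x F x = F i + F j + F k + F m.
Proof.
rewrite (eq_bigl (mem [:: i; j; k; m])) => [|x]; last by rewrite /= mem_ijkm.
by rewrite -big_uniq // !big_cons big_nil /= addr0 !addrA.
Qed.

Lemma sum_v_ijkm : v i = - (v j + v k + v m).
Proof. by apply/eqP; rewrite -addr_eq0 !addrA -sum_ijkm sum_v. Qed.

Lemma v_extend_ijkm n (y z t : 'cV[int]_n) : exists M : 'M[int]_(n, 3),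
  [/\ M *m v j = y, M *m v k = z & M *m v m = t].
Proof.
pose s := [:: i; j; k; m].
pose f x := nth 0 [:: - (y + z + t); y; z; t] (index x s).
have fE a : (a < 4)%N -> f (nth i s a) = nth 0 [:: - (y + z + t); y; z; t] a.
  by move=> a4; rewrite /f index_uniq.
have [|M Mf] := @v_extend n f.
  by rewrite sum_ijkm (fE 0) // (fE 1) // (fE 2) // (fE 3) // -!addrA addNr.
by exists M; rewrite !Mf (fE 1) // (fE 2) // (fE 3).
Qed.

(** The exceptional rays v_p, v_l1, v_l2 come last, in the order of the blowups, so that each gets
    the next free label 4, 5, 6. *)
Definition ray_seq : seq lattice :=
  [:: v i; v j; v k; v m; v j + v k + v m; v i + v j; v i + v k].

Definition ray := nth 0 ray_seq.

Lemma ray_seq_uniq : uniq ray_seq.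
Proof.
(* The functional v_j, v_k, v_m |-> 1, 3, 9 separates the seven rays. *)
have [M [Mj Mk Mm]] := @v_extend_ijkm 1 (const_mx 1) (const_mx 3) (const_mx 9).
apply: (@map_uniq _ _ (fun u => (M *m u) 0 0)).
by rewrite /= !mulmxDr sum_v_ijkm mulmxN !mulmxDr Mj Mk Mm !mxE.
Qed.

Lemma eq_ray a b : (a < 7)%N -> (b < 7)%N -> (ray a == ray b) = (a == b).
Proof. by move=> *; apply: nth_uniq; rewrite // ray_seq_uniq. Qed.

Lemma gens_point : gens [set j; k; m] = [fset ray 1; ray 2; ray 3].
Proof.
apply/fsetP => u; rewrite !inE; apply/imfsetP/idP => [[x /=]|].
  by rewrite !inE => /orP[/orP[]|] /eqP-> ->; rewrite eqxx ?orbT.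
by move=> /orP[/orP[]|] /eqP->; [exists j|exists k|exists m];
   rewrite //= !inE eqxx ?orbT.
Qed.

Lemma gens_pair x y : gens [set x; y] = [fset v x; v y].
Proof.
apply/fsetP => u; rewrite !inE; apply/imfsetP/idP => [[z /=]|].
  by rewrite !inE => /orP[] /eqP-> ->; rewrite eqxx ?orbT.
by move=> /orP[] /eqP->; [exists x|exists y]; rewrite //= !inE eqxx ?orbT.
Qed.

Lemma gensT : gens setT = [fset ray 0; ray 1; ray 2; ray 3].
Proof.
apply/fsetP => u; rewrite !inE; apply/imfsetP/idP => [[x _ ->]|].
  by have := mem_ijkm x; rewrite !inE => /or4P[] /eqP->; rewrite eqxx ?orbT.
by rewrite -!orbA => /or4P[] /eqP->; [exists i|exists j|exists k|exists m];
   rewrite //= !inE.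
Qed.

Lemma sum_point (V : nmodType) (F : 'I_4 -> V) :
  \sum_(x in [set j; k; m]) F x = F j + F k + F m.
Proof.
rewrite (eq_bigl (mem [:: j; k; m])) => [|x]; last by rewrite /= !inE orbA.
rewrite -big_uniq; last by case/andP: ijkm.
by rewrite !big_cons big_nil /= addr0 addrA.
Qed.

Lemma barycenter_point : barycenter (gens [set j; k; m]) = ray 4.
Proof. by rewrite barycenter_gens sum_point. Qed.

Lemma barycenter_pair x y : x != y -> barycenter (gens [set x; y]) = v x + v y.
Proof. by move=> xy; rewrite barycenter_gens big_setU1 ?inE ?big_set1. Qed.

(* The minimal sets of labels (positions in ray_seq) spanning no cone of X. *)
Definition nonfaces : seq (seq nat) :=
  [:: [:: 0; 1]; [:: 0; 2]; [:: 0; 4]; [:: 1; 6]; [:: 4; 5]; [:: 4; 6];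
      [:: 1; 2; 3]; [:: 2; 3; 5]; [:: 3; 5; 6]]%N.

Definition X : fan := blowup (gens [set i; k])
  (blowup (gens [set i; j]) (blowup (gens [set j; k; m]) P3)).

Lemma in_X A : (A \in X) =
  (A `<=` face ray (iota 0 7)) &&
  all (fun q => ~~ all (fun a => ray a \in A) q) nonfaces.
Proof.
have [ij ik] := neq_ijk.
have g0 : gens [set j; k; m] = face ray [:: 1; 2; 3]%N.
  by rewrite gens_point; apply/fsetP => u; rewrite !inE orbF -?orbA.
have g1 : gens [set i; j] = face ray [:: 0; 1]%N.
  by rewrite gens_pair; apply/fsetP => u; rewrite !inE orbF.
have g2 : gens [set i; k] = face ray [:: 0; 2]%N.
  by rewrite gens_pair; apply/fsetP => u; rewrite !inE orbF.
have gT : gens setT = face ray (iota 0 4).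
  by rewrite gensT; apply/fsetP => u; rewrite !inE orbF -?orbA.
have b0 : barycenter (face ray [:: 1; 2; 3]%N) = ray 4.
  by rewrite -g0 barycenter_point.
have b1 : barycenter (face ray [:: 0; 1]%N) = ray 5.
  by rewrite -g1 barycenter_pair.
have b2 : barycenter (face ray [:: 0; 2]%N) = ray 6.
  by rewrite -g2 barycenter_pair.
have X0 : fan_avoiding (face ray (iota 0 4))
    [seq face ray q | q <- [:: iota 0 4]] P3.
  by rewrite /= -gT; apply: P3_avoiding.
have X1 := face_blowup eq_ray X0 b0 isT isT isT.
have X2 := face_blowup eq_ray X1 b1 isT isT isT.
have [XE _] := face_blowup eq_ray X2 b2 isT isT isT.
rewrite /X g0 g1 g2 XE /avoiding all_map; congr andb.
rewrite (eq_all (a2 := fun q => ~~ all (fun a => ray a \in A) q)); last first.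
  by move=> q /=; rewrite face_sub.
(* Discarding the redundant nonfaces is a tautology in the seven truth values of [r a \in A]. *)
move: ray => r /=.
by do 7![case: (_ \in A)].
Qed.

Definition is_face (q : seq nat) : bool :=
  all (fun p => ~~ all (mem q) p) nonfaces.

Lemma face_in_X q : all (gtn 7) q -> (face ray q \in X) = is_face q.
Proof.
move=> q7; rewrite in_X face_sub; case: allP => [_|]; last first.
  by case=> a /(allP q7) a7; rewrite in_fset map_f // mem_iota.
have nf7 : {in nonfaces, forall p, all (gtn 7) p} by apply/allP.
apply: eq_in_all => p /nf7 /allP p7; congr (~~ _).
by apply: eq_in_all => a /p7 a7; rewrite (mem_face eq_ray).
Qed.

Lemma mem_faceP u : reflect (exists2 a, (a < 7)%N & u = ray a)
  (u \in face ray (iota 0 7)).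
Proof.
rewrite in_fset; apply: (iffP mapP) => -[a].
  by rewrite mem_iota; exists a.
by move=> a7 ->; exists a; rewrite ?mem_iota.
Qed.

(** * The linear involution of the fan *)

Definition swap : seq nat := [:: 4; 6; 5; 3; 0; 2; 1]%N.

Lemma swap_lt a : (a < 7)%N -> (nth 0 swap a < 7)%N.
Proof. by do 7![case: a => // a]. Qed.

Lemma swapK a : (a < 7)%N -> nth 0%N swap (nth 0 swap a) = a.
Proof. by do 7![case: a => // a]. Qed.

Lemma mx_ext_ray (M N : 'M[int]_3) :
  (forall a, (a < 7)%N -> M *m ray a = N *m ray a) -> M = N.
Proof.
move=> MN; apply: v_ext => x; have := mem_ijkm x; rewrite !inE.
by case/or4P => /eqP->;
  [apply: (MN 0)|apply: (MN 1)|apply: (MN 2)|apply: (MN 3)].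
Qed.

(** The images of the basis v_j, v_k, v_m determine [M]; the other rays follow from v_i = -(v_j +
    v_k + v_m). For instance, v_i goes to -(2 v_i + v_j + v_k + v_m) = -v_i = v_p. *)
Lemma swap_mx_exists : exists M : 'M[int]_3,
  forall a, (a < 7)%N -> M *m ray a = ray (nth 0 swap a).
Proof.
have [M [Mj Mk Mm]] := v_extend_ijkm (ray 6) (ray 5) (ray 3).
exists M; case=> [|[|[|[|[|[|[|//]]]]]]] _; rewrite /ray /= ?mulmxDr
  ?sum_v_ijkm ?mulmxN ?mulmxDr ?Mj ?Mk ?Mm /ray /= ?sum_v_ijkm //;
  apply/colP => c; rewrite !mxE; ring.
Qed.

Section Swap.
Variable M : 'M[int]_3.
Hypothesis M_ray : forall a, (a < 7)%N -> M *m ray a = ray (nth 0 swap a).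

Lemma swap_mxK : M *m M = 1%:M.
Proof.
apply: mx_ext_ray => a a7.
by rewrite -mulmxA !M_ray ?swap_lt // swapK // mul1mx.
Qed.

Lemma swap_mx_mulK n : cancel (@mulmx _ 3 3 n M) (mulmx M).
Proof. by move=> u; rewrite mulmxA swap_mxK mul1mx. Qed.

Lemma swap_image_in_X A : A \in X -> [fset M *m u | u in A] \in X.
Proof.
rewrite !in_X => /andP[/fsubsetP AR].
have mem_image a : (a < 7)%N ->
    (ray a \in [fset M *m u | u in A]) = (ray (nth 0 swap a) \in A).
  move=> a7; apply/imfsetP/idP => /= [[u uA au]|aA].
    by rewrite -M_ray // au swap_mx_mulK.
  by exists (ray (nth 0 swap a)); rewrite // M_ray ?swap_lt ?swapK.
move=> nonfaceA; apply/andP; split.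
  apply/fsubsetP => _ /imfsetP[u /AR/mem_faceP[a a7 ->] ->] /=.
  by apply/mem_faceP; exists (nth 0 swap a); rewrite ?M_ray ?swap_lt.
(* [swap] permutes the nine nonfaces, so both sides are the same nine conditions on [A]. *)
move: nonfaceA; rewrite /= !mem_image //=.
move: ray => r; by do 7![case: (_ \in A)].
Qed.

Lemma swap_permutes_cones : permutes_cones X M.
Proof.
have MK (A : cone) : [fset M *m u | u in [fset M *m u | u in A]] = A.
  apply/fsetP => u; apply/imfsetP/idP => /= [[_ /imfsetP[w wA ->] ->]|uA].
    by rewrite swap_mx_mulK.
  exists (M *m u); last by rewrite swap_mx_mulK.
  by apply/imfsetP; exists u.
apply/eqP/fsetP => A; apply/imfsetP/idP => /= [[B BX ->]|AX].
  exact: swap_image_in_X.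
by exists [fset M *m u | u in A]; rewrite ?MK ?swap_image_in_X.
Qed.

End Swap.

(** * Rigidity: the only possible symmetries *)

Lemma nonface_automorphism s : s \in permutations (iota 0 7) ->
    {in nonfaces, forall q, ~~ is_face [seq nth 0%N s a | a <- q]} ->
  s \in [:: iota 0 7; swap].
Proof.
pose preserving s :=
  all (fun q => ~~ is_face [seq nth 0%N s a | a <- q]) nonfaces.
(* All 5040 permutations of the labels are tested by evaluation. *)
have : all (fun s => preserving s ==> (s \in [:: iota 0 7; swap]))
    (permutations (iota 0 7)) by vm_compute.
by move=> /allP sP /sP /implyP sE sN; apply/sE/allP.
Qed.

Section Rigidity.
Variable g : 'M[int]_3.
Hypotheses (g_unit : g \in unitmx) (gX : permutes_cones X g).

Let g_inj : injective (@mulmx _ 3 3 1 g).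
Proof. exact: can_inj (mulKmx g_unit). Qed.

Lemma image_in_X A : ([fset g *m u | u in A] \in X) = (A \in X).
Proof.
have gS (B C : cone) :
    [fset g *m u | u in B] `<=` [fset g *m u | u in C] -> B `<=` C.
  move=> /fsubsetP gBC; apply/fsubsetP => u uB.
  by have /imfsetP[w wC /g_inj->] := gBC _ (in_imfset _ (mulmx g) uB).
rewrite -{1}(eqP gX); apply/imfsetP/idP => /= [[B BX AB]|AX]; last by exists A.
suff -> : (A : cone) = B by [].
by apply/eqP; rewrite eqEfsubset; apply/andP; split; apply: gS; rewrite AB.
Qed.

(** The rays are the one-element cones, so [g] permutes them; by [image_in_X] it sends nonfaces to
    nonfaces, and [nonface_automorphism] applies to the induced permutation of labels. *)
Lemma symmetry_rays : exists2 s, s \in [:: iota 0 7; swap] &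
  forall a, (a < 7)%N -> g *m ray a = ray (nth 0%N s a).
Proof.
have g_rays a : (a < 7)%N -> exists2 b, (b < 7)%N & g *m ray a = ray b.
  move=> a7; have : face ray [:: a] \in X.
    have ray_faces : all (fun a => is_face [:: a]) (iota 0 7) by [].
    rewrite face_in_X; last by rewrite /= a7.
    by apply: (allP ray_faces); rewrite mem_iota.
  rewrite -image_in_X in_X => /andP[/fsubsetP gR _]; apply/mem_faceP/gR.
  by apply/imfsetP; exists (ray a); rewrite //= in_fset mem_head.
have [f f7 fE] : exists2 f : nat -> nat, forall a, (a < 7)%N -> (f a < 7)%N &
    forall a, (a < 7)%N -> ray (f a) = g *m ray a.
  exists (fun a => index (g *m ray a) ray_seq) => a /g_rays[b b7 ->].
    by rewrite (index_mem _ ray_seq); apply: mem_nth.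
  by rewrite /ray nth_index //; apply: mem_nth.
exists (mkseq f 7); last by move=> a a7; rewrite nth_mkseq // fE.
apply: nonface_automorphism => [|q qN].
  have f_uniq : uniq (mkseq f 7).
    rewrite map_inj_in_uniq ?iota_uniq // => a b.
    rewrite !mem_iota => a7 b7 fab.
    apply/eqP; rewrite -eq_ray //; apply/eqP/g_inj.
    by rewrite /= -!fE // fab.
  rewrite mem_permutations; apply: uniq_perm => //.
  (* Seven distinct labels below 7 exhaust them. *)
  have [||//] := uniq_min_size f_uniq (s2 := iota 0 7).
    by move=> _ /mapP[a a7 ->]; move: a7; rewrite !mem_iota; apply: f7.
  by rewrite size_mkseq.
have q7 : {in q, forall a, (a < 7)%N}.
  by apply/allP; move: q qN; apply/allP.
have -> : [seq nth 0%N (mkseq f 7) a | a <- q] = [seq f a | a <- q].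
  by apply/eq_in_map => a /q7 a7; rewrite nth_mkseq.
have fq7 : all (gtn 7) [seq f a | a <- q].
  by apply/allP => _ /mapP[a /q7 a7 ->]; apply: f7.
rewrite -face_in_X //.
have -> : face ray [seq f a | a <- q] = [fset g *m u | u in face ray q].
  apply/fsetP => u; rewrite in_fset; apply/mapP/imfsetP => /=.
    case=> _ /mapP[a aq ->] ->; exists (ray a); first by rewrite in_fset map_f.
    by rewrite fE // q7.
  case=> w; rewrite in_fset => /mapP[a aq ->] ->; exists (f a).
    exact: map_f.
  by rewrite fE // q7.
rewrite image_in_X face_in_X; last exact/allP.
by apply/allPn; exists q; rewrite // negbK; apply/allP.
Qed.

End Rigidity.

(** * Intersection numbers and the action on classes *)

Lemma inter_class_of p l1 l2 d a1 a2 a3 (r : rays (fanX p l1 l2)) c :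
  sval p = [set j; k; m] -> sval l1 = [set i; j] -> sval l2 = [set i; k] ->
  (c < 7)%N -> val r = ray c ->
  class_of p l1 l2 d a1 a2 a3 r =
    nth 0 [:: d - a2 - a3; d - a1 - a2; d - a1 - a3; d - a1; a1; a2; a3] c.
Proof.
move=> pE l1E l2E c7 rc.
have [ij ik] := neq_ijk.
have interB (x y : H2 (fanX p l1 l2)) : (x - y) r = x r - y r.
  by rewrite -[LHS]/((inter x - inter y) r) !ffunE.
have interMz (x : H2 (fanX p l1 l2)) n : (x *~ n) r = x r * n.
  rewrite -[inter (x *~ n)]/(val (x *~ n)) raddfMz /= -mulrzz.
  by case: n => n; rewrite -?pmulrn ?NegzE ?mulrNz -?pmulrn ?ffunE ffunMnE.
(* [D_(v x)] contributes [d], minus the coefficient of each centre whose index set contains [x]; an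
   exceptional divisor contributes its own coefficient. *)
rewrite /class_of !interB !interMz /= !(sum_ffunE, ffunE) /=.
rewrite pE l1E l2E barycenter_point !barycenter_pair // sum_ijkm sum_point.
rewrite !big_setU1 ?inE // !big_set1 !ffunE /= rc.
(* Once every vector is a [ray], the values of [delta] become comparisons of labels. *)
rewrite -[v i]/(ray 0) -[v j]/(ray 1) -[v k]/(ray 2) -[v m]/(ray 3).
rewrite -[ray 0 + ray 1]/(ray 5) -[ray 0 + ray 2]/(ray 6) !eq_ray //.
by move: c c7 {rc}; do 7![case=> [_ /=|]; first lia].
Qed.

Lemma nontrivial_symmetry_ijkm p l1 l2 :
  sval p = [set j; k; m] -> sval l1 = [set i; j] -> sval l2 = [set i; k] ->
  exists tauA : toric_symmetry (fanX p l1 l2),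
    unique (@nontrivial p l1 l2) tauA /\
    forall d a1 a2 a3 : int,
      pushforward tauA (class_of p l1 l2 d a1 a2 a3) =
      class_of p l1 l2 (2 * d - a1 - a2 - a3)
        (d - a2 - a3) (d - a1 - a3) (d - a1 - a2).
Proof.
move=> pE l1E l2E; have XE : fanX p l1 l2 = X by rewrite /fanX pE l1E l2E.
have [M M_ray] := swap_mx_exists.
have MP : (M \in unitmx) && permutes_cones (fanX p l1 l2) M.
  rewrite XE swap_permutes_cones // andbT.
  by case: (mulmx1_unit (swap_mxK M_ray)).
exists (ToricSymmetry MP); split.
  (* [M] sends v_p to v_i, so it does not preserve the set of exceptional rays over points.
     Conversely, a nontrivial [g] cannot fix all rays, so it agrees with [M] on them. *)
  split=> [[_ /fsetP/(_ (ray 0)) + _]|g gN].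
    rewrite /v_point pE barycenter_point in_fset1 eq_ray // => /negbT/imfsetP[].
    by exists (ray 4); rewrite ?in_fset1 //= M_ray.
  apply/val_inj/mx_ext_ray => a a7 /=; rewrite M_ray //.
  have /andP[gU] := sym_mxP g; rewrite {1}XE => gX.
  have [s] := symmetry_rays gU gX; rewrite !inE => /orP[] /eqP-> gs;
    last by rewrite gs.
  case: gN; have -> : sym_mx g = 1%:M.
    by apply: mx_ext_ray => b b7; rewrite gs // nth_iota // mul1mx.
  have id_preserves A : preserves 1%:M A.
    apply/fsetP => u; apply/imfsetP/idP => /= [[w wA ->]|uA].
      by rewrite mul1mx.
    by exists u; rewrite ?mul1mx.
  by split; apply: id_preserves.
move=> d a1 a2 a3; apply/val_inj/ffunP => r; rewrite /= ffunE.
(* Writing the ray as the image of its preimage, it remains to compare the old class at label [c]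
   with the new one at label [nth 0 swap c]. *)
set tau := ToricSymmetry MP; rewrite -[r in RHS](permKV (sym_perm tau)).
move: (_ r) => {}r.
have rX : val r \in face ray (iota 0 7).
  case/bigfcupP: (valP r) => A; rewrite andbT.
  have -> : (A \in fanX p l1 l2) = (A \in X) by rewrite XE.
  by rewrite in_X => /andP[/fsubsetP AR _] /AR.
have /mem_faceP[c c7 rc] := rX.
rewrite (inter_class_of _ _ _ _ pE l1E l2E c7 rc).
have c7' := swap_lt c7.
rewrite (inter_class_of _ _ _ _ pE l1E l2E c7'); last first.
  by rewrite permE /= rc M_ray.
by move: c c7 {rc c7'}; do 7![case=> [_ /=|]; first lia].
Qed.

End Rays.

(** * Choice of the four indices *)

Theorem theorem2 (p : point) (l1 l2 : line)
    (l1_neq_l2 : l1 <> l2) (l1_meets_l2 : meet l1 l2)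
    (p_off_l1 : ~~ on_line l1 p) (p_off_l2 : ~~ on_line l2 p) :
  exists tauA : toric_symmetry (fanX p l1 l2),
    unique (@nontrivial p l1 l2) tauA /\
    forall d a1 a2 a3 : int,
      pushforward tauA (class_of p l1 l2 d a1 a2 a3) =
      class_of p l1 l2 (2 * d - a1 - a2 - a3)
        (d - a2 - a3) (d - a1 - a3) (d - a1 - a2).
Proof.
have card_C (I : {set 'I_4}) n : #|I| = n -> #|~: I| = (4 - n)%N.
  by move=> In; rewrite cardsCs setCK In card_ord.
have /eqP/cards1P[i pC] := card_C _ _ (eqP (valP p)).
(* A line off [p] has an index outside [sval p], and [i] is the only such index. *)
have through_i l : ~~ on_line l p -> exists2 j, i != j & sval l = [set i; j].
  case/subsetPn => x xl; rewrite -in_setC [~: _]pC inE => /eqP xi.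
  rewrite {x}xi in xl.
  have : #|sval l :\ i| == 1%N.
    have := cardsD1 i (sval l); rewrite (eqP (valP l)) xl => /eqP.
    by rewrite eqSS eq_sym.
  case/cards1P => j lj; exists j; last by rewrite -lj setD1K.
  have : j \in sval l :\ i by rewrite lj inE.
  by rewrite !inE eq_sym => /andP[].
have [j ij l1E] := through_i l1 p_off_l1.
have [k ik l2E] := through_i l2 p_off_l2.
have jk : j != k.
  by apply/eqP => jk; apply: l1_neq_l2; apply: val_inj; rewrite /= l1E l2E jk.
have /eqP/cards1P[m mE] : #|~: [set i; j; k]| = 1%N.
  apply: (card_C _ 3).
  by rewrite -setUA !cardsU1 !inE negb_or ij ik jk cards1.
have : m \in ~: [set i; j; k] by rewrite mE inE.
rewrite !inE !negb_or => /andP[/andP[mi mj] mk].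
apply: (@nontrivial_symmetry_ijkm i j k m) => //.
  by rewrite /= !inE !negb_or ij ik jk /= ![_ == m]eq_sym mi mj mk.
(* The point is identified through its complement, the singleton of [i]. *)
apply: setC_inj; rewrite [LHS]pC; apply/setP => x.
have := congr1 (fun A : {set _} => x \in A) mE; rewrite !inE.
case: eqVneq => [->|xi] /= => [_|<-].
  by rewrite (negPf ij) (negPf ik) eq_sym (negPf mi).
by case: (x == j); case: (x == k).
Qed.
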